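(* Let $C\subset\mathbb{R}^2$ be a circle and let $\alpha\in(0,\pi)$. There exists a shape $S$ of constant angle $\alpha$ (with respect to $C$) which is not a disk if and only if $\alpha=\tfrac{p}{q}\pi$, where $p,q$ are two coprime positive integers with $p<q$ and $q-p$ odd. Moreover, in that case there are uncountably many shapes of constant angle $\alpha$ (with respect to $C$) which are not disks.
   Context: Let $S\subset\mathbb{R}^2$ be a closed convex set (a ''shape''). For a point $P\notin S$, the union of all rays $PQ$ with $Q$ varying in $S$ is a cone with apex $P$; the angle of sight at $P$ to $S$ is the angle of this cone, i.e. the angle between the two tangent lines from $P$ to $S$ (measured on the side containing $S$). Given a circle $C$, one considers shapes $S$ lying inside the disk bounded by $C$ (with no point of $S$ on $C$, so that the angle of sight is defined at every point of $C$). Such an $S$ is called a shape of constant angle $\alpha$ (with respect to $C$) if the angle of sight at $P$ to $S$ equals $\alpha$ for every $P\in C$. *)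

(* Defs.v *)
From HB Require Import structures.
From mathcomp Require Import all_boot all_order all_algebra.
From mathcomp Require Import all_classical all_reals all_analysis.

Set Implicit Arguments.
Unset Strict Implicit.
Unset Printing Implicit Defensive.

Import Order.TTheory GRing.Theory Num.Theory.
Import numFieldNormedType.Exports.

Local Open Scope classical_set_scope.
Local Open Scope ring_scope.

(* The library norm on a product is the max norm: it induces the usual topology
   of the plane, but circles and disks need the Euclidean distance below. *)
Definition plane (R : realType) := (R^o * R^o)%type.

Definition edist (R : realType) (P Q : plane R) : R :=
  Num.sqrt ((P.1 - Q.1) ^+ 2 + (P.2 - Q.2) ^+ 2).

Definition circle (R : realType) (O : plane R) (r : R) : set (plane R) :=
  [set P | edist P O = r].

Definition disk (R : realType) (O : plane R) (r : R) : set (plane R) :=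
  [set P | edist P O <= r].

Definition is_disk (R : realType) (S : set (plane R)) : Prop :=
  exists (O : plane R) (r : R), 0 < r /\ S = disk O r.

Definition convex_shape (R : realType) (S : set (plane R)) : Prop :=
  closed S /\ convex_set S.

Definition ray (R : realType) (P Q : plane R) : set (plane R) :=
  [set P + k *: (Q - P) | k in [set k : R | 0 <= k]].

Definition sight_cone (R : realType) (P : plane R) (S : set (plane R)) :
    set (plane R) :=
  \bigcup_(Q in S) ray P Q.

(* Closed sector with apex P swept counterclockwise, by the angle a, from the
   direction (cos t, sin t). *)
Definition sector (R : realType) (P : plane R) (t a : R) : set (plane R) :=
  [set X | exists k u : R, [/\ 0 <= k, t <= u <= t + a &
     X = P + k *: ((cos u, sin u) : plane R)]].

(* A functional relation between (P, S) and a: on 0 <= a < 2 pi a sector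
   determines its angle. *)
Definition angle_of_sight (R : realType) (P : plane R) (S : set (plane R))
    (a : R) : Prop :=
  [/\ P \notin S, 0 <= a < 2 * pi &
      exists t : R, sight_cone P S = sector P t a].

Definition constant_angle_shape (R : realType) (O : plane R) (r a : R)
    (S : set (plane R)) : Prop :=
  [/\ convex_shape S,
      S `<=` disk O r,
      S `&` circle O r = set0 &
      forall P, circle O r P -> angle_of_sight P S a].

(* Main.v *)
Require Import Defs.
From HB Require Import structures.
From mathcomp Require Import all_boot all_order all_algebra.
From mathcomp Require Import all_classical all_reals all_analysis.
From mathcomp Require Import ring lra.
Import Order.TTheory GRing.Theory Num.Theory.
Import numFieldNormedType.Exports.
Local Open Scope classical_set_scope.
Local Open Scope ring_scope.

Set Implicit Arguments.
Unset Strict Implicit.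
Unset Printing Implicit Defensive.

(** Let [h] be the support function of [S] seen from the center [O] of the
    circle, and write [h t = r * cos (b t)] with [0 < b t < pi]: the supporting
    line with outer normal [t] meets the circle at [O + r * (direction t + b t)]
    and at [O + r * (direction t - b t)]. With [c = pi - a], the two tangents from
    a point of the circle have outer normals [t] and [t + c] for some [t], so
    constancy of the angle of sight means [b (t + c) = c - b t]. Hence
    [g = b - c / 2] is continuous, [2 pi]-periodic and changes sign under the
    translation by [c]. If [g] is not identically zero, the translations that
    preserve [g] up to sign form a discrete, hence cyclic, group, and comparing
    [c] and [2 pi] with a generator gives [c = (m / n) pi] with [m] odd. If [g]
    vanishes, [h] is constant and [S] is a disk. Conversely, for
    [c = (m / q) pi] with [m] odd, [b t = c / 2 + e * cos (q t)] satisfies the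
    functional equation, and for small [e > 0] it defines a support function
    since [h + h'' >= 0]; distinct [e] give distinct shapes. *)

(** * Plane vectors, polar coordinates and sectors *)

Definition udir {R : realType} (t : R) : plane R := (cos t, sin t).

Definition dotp {R : realType} (v w : plane R) : R := v.1 * w.1 + v.2 * w.2.

Section Plane.
Context {R : realType}.
Implicit Types (v V P Q X O : plane R) (t a b w : R).

Lemma planeP v V : v.1 = V.1 -> v.2 = V.2 -> v = V.
Proof. by case: v => ? ?; case: V => ? ? /= -> ->. Qed.

Lemma fstDE v V : (v + V).1 = (v.1 : R) + V.1. Proof. by []. Qed.
Lemma sndDE v V : (v + V).2 = (v.2 : R) + V.2. Proof. by []. Qed.
Lemma fstNE v : (- v).1 = - (v.1 : R). Proof. by []. Qed.
Lemma sndNE v : (- v).2 = - (v.2 : R). Proof. by []. Qed.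
Lemma fstZE a v : (a *: v).1 = a * v.1. Proof. by []. Qed.
Lemma sndZE a v : (a *: v).2 = a * v.2. Proof. by []. Qed.
Lemma fst_udir t : (udir t).1 = cos t. Proof. by []. Qed.
Lemma snd_udir t : (udir t).2 = sin t. Proof. by []. Qed.
Lemma fst0E : (0 : plane R).1 = 0 :> R. Proof. by []. Qed.
Lemma snd0E : (0 : plane R).2 = 0 :> R. Proof. by []. Qed.
Definition planeE :=
  (fstDE, sndDE, fstNE, sndNE, fstZE, sndZE, fst0E, snd0E, fst_udir, snd_udir).

Lemma dotp_udir t s : dotp (udir t) (udir s) = cos (t - s).
Proof. by rewrite /dotp/= cosB. Qed.

Lemma dotpDl v V X : dotp (v + V) X = dotp v X + dotp V X.
Proof. by rewrite /dotp !planeE; ring. Qed.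

Lemma dotpNl v X : dotp (- v) X = - dotp v X.
Proof. by rewrite /dotp !planeE; ring. Qed.

Lemma dotpBl v V X : dotp (v - V) X = dotp v X - dotp V X.
Proof. by rewrite dotpDl dotpNl. Qed.

Lemma dotpZl a v X : dotp (a *: v) X = a * dotp v X.
Proof. by rewrite /dotp !planeE; ring. Qed.

Lemma eucl_distE P Q : Defs.edist P Q ^+ 2 = dotp (P - Q) (P - Q).
Proof. by rewrite /Defs.edist sqr_sqrtr ?addr_ge0 ?sqr_ge0// /dotp !planeE; ring. Qed.

Lemma eucl_dist_ge0 P Q : 0 <= Defs.edist P Q.
Proof. exact: sqrtr_ge0. Qed.

Lemma dotp_ge0 v : 0 <= dotp v v.
Proof. by rewrite /dotp -!expr2 addr_ge0 ?sqr_ge0. Qed.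

Lemma eucl_dist_le P Q a : 0 <= a -> (Defs.edist P Q <= a) = (dotp (P - Q) (P - Q) <= a ^+ 2).
Proof. by move=> a0; rewrite -eucl_distE ler_pXn2r// nnegrE eucl_dist_ge0. Qed.

Lemma eucl_dist_lt P Q a : 0 <= a -> (Defs.edist P Q < a) = (dotp (P - Q) (P - Q) < a ^+ 2).
Proof. by move=> a0; rewrite -eucl_distE ltr_pXn2r// nnegrE eucl_dist_ge0. Qed.

(** In the upper half-plane the angle is [acos (x / k)], because the sine is nonnegative on [0, pi];
    [polar] gets the lower half by reflection. *)
Lemma polar_upper (x y : R) : 0 <= y ->
  exists k w, [/\ 0 <= k, 0 <= w <= pi, x = k * cos w & y = k * sin w].
Proof.
move=> y0.
have [k k2 k0] : exists2 k : R, k ^+ 2 = x ^+ 2 + y ^+ 2 & 0 <= k.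
  by exists (Num.sqrt (x ^+ 2 + y ^+ 2)); rewrite ?sqr_sqrtr ?addr_ge0 ?sqr_ge0 ?sqrtr_ge0.
move: k0; rewrite le_eqVlt => /predU1P[k0|k0].
  have : x ^+ 2 + y ^+ 2 = 0 by rewrite -k2 -k0 expr0n.
  move/eqP; rewrite paddr_eq0 ?sqr_ge0// !sqrf_eq0 => /andP[/eqP -> /eqP ->].
  by exists 0, 0; rewrite !mul0r lexx pi_ge0.
have xk : -1 <= x / k <= 1.
  rewrite -ler_norml -(@ler_pXn2r _ 2%N)// ?nnegrE//.
  rewrite real_normK ?num_real// expr1n exprMn exprVn.
  by rewrite ler_pdivrMr ?exprn_gt0// mul1r k2 lerDl sqr_ge0.
exists k, (acos (x / k)); split.
- exact: ltW.
- by rewrite acos_ge0// acos_lepi.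
- by rewrite acosK ?in_itv//= mulrC divfK// gt_eqF.
- rewrite sin_acos//; apply/eqP; rewrite -(@eqrXn2 _ 2%N)//; last first.
    by rewrite mulr_ge0 ?sqrtr_ge0// ltW.
  have e : 1 - (x / k) ^+ 2 = y ^+ 2 / k ^+ 2.
    by rewrite exprMn exprVn k2; field; rewrite -k2 expf_neq0// gt_eqF.
  rewrite [eqbRHS]exprMn sqr_sqrtr; last by rewrite e divr_ge0 ?sqr_ge0.
  by rewrite e mulrC divfK// expf_neq0// gt_eqF.
Qed.

Lemma polar v : exists k w, 0 <= k /\ v = k *: udir w.
Proof.
case: v => x y; have [y0|/ltW y0] := lerP 0 y.
  by have [k [w [k0 _ -> ->]]] := polar_upper x y0; exists k, w.
have [|k [w [k0 _ xe ye]]] := @polar_upper x (- y); first by rewrite oppr_ge0.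
exists k, (- w); split => //; apply: planeP; rewrite !planeE/= ?cosN ?sinN//.
by rewrite -[LHS]opprK ye -mulrN.
Qed.

Lemma dotp_le_norm v t a : 0 <= a -> dotp v v <= a ^+ 2 -> dotp v (udir t) <= a.
Proof.
move=> a0; have [k [w [k0 ->]]] := polar v.
rewrite !dotpZl dotp_udir /dotp !planeE => h.
have {h} : k ^+ 2 <= a ^+ 2.
  suff <- : k * (cos w * (k * cos w) + sin w * (k * sin w)) = k ^+ 2 by [].
  by have e := sin2cos2 w; ring: e.
rewrite ler_pXn2r// ?nnegrE// => ka.
by apply: le_trans ka; rewrite ler_piMr// cos_le1.
Qed.

(** Cramer's rule for [udir w] in the basis [udir t], [udir (t + a)], with the determinant [sin a]
    cleared. *)
Lemma sin_split t a w :
  sin a *: udir w = sin (t + a - w) *: udir t + sin (w - t) *: udir (t + a).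
Proof.
have e := sin2cos2 t; apply: planeP; rewrite !planeE !(sinB, sinD, cosD);
 ring: e.
Qed.

(** Angles become signs: since [a < pi], the Cramer coordinates of a direction are both nonnegative
    exactly between the two boundary directions. *)
Lemma sectorP P t a X : 0 < a < pi -> sector P t a X <->
  exists a1 a2, [/\ 0 <= a1, 0 <= a2 & X = P + (a1 *: udir t + a2 *: udir (t + a))].
Proof.
move=> /andP[a0 api]; have sa : 0 < sin a by rewrite sin_gt0_pi// a0.
split=> [[k [w [k0 /andP[tw wt] ->]]]|[a1 [a2 [a10 a20 ->]]]].
  exists (k * sin (t + a - w) / sin a), (k * sin (w - t) / sin a); split.
  - by rewrite divr_ge0 ?(ltW sa)// mulr_ge0// sin_ge0_pi//; lra.
  - by rewrite divr_ge0 ?(ltW sa)// mulr_ge0// sin_ge0_pi//; lra.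
  - have -> : (cos w, sin w) = (sin a)^-1 *: (sin a *: udir w).
      by rewrite scalerA mulVf ?scale1r// gt_eqF.
    by rewrite (sin_split t); apply: planeP; rewrite !planeE; ring.
(* Turned by [- t], the combination lies in the upper half-plane, so only [w <= a] is left to
   prove. *)
have [k [w [k0 /andP[w0 wpi] ex ey]]] :=
  @polar_upper (a1 + a2 * cos a) (a2 * sin a) (mulr_ge0 a20 (ltW sa)).
have eXP : a1 *: udir t + a2 *: udir (t + a) = k *: udir (t + w).
  have e1 : k * cos (t + w) = cos t * (k * cos w) - sin t * (k * sin w).
    by rewrite cosD; ring.
  have e2 : k * sin (t + w) = sin t * (k * cos w) + cos t * (k * sin w).
    by rewrite sinD; ring.
  apply: planeP; rewrite !planeE.
    by rewrite e1 -ex -ey cosD; ring.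
  by rewrite e2 -ex -ey sinD; ring.
rewrite eXP; move: k0; rewrite le_eqVlt => /predU1P[<-|k0].
  by exists 0, t; split; rewrite ?scale0r//; lra.
exists k, (t + w); split => //; first exact: ltW.
have : 0 <= k * sin (a - w).
  rewrite sinB mulrDr mulrN.
  have -> : k * (sin a * cos w) = sin a * (k * cos w) by ring.
  have -> : k * (cos a * sin w) = cos a * (k * sin w) by ring.
  rewrite -ex -ey.
  have -> : sin a * (a1 + a2 * cos a) - cos a * (a2 * sin a) = a1 * sin a by ring.
  by rewrite mulr_ge0// ltW.
rewrite pmulr_rge0// => h; apply/andP; split; first lra.
rewrite lerD2l leNgt; apply/negP => aw; move: h.
by rewrite leNgt -opprB sinN oppr_lt0 sin_gt0_pi//; lra.
Qed.

End Plane.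

(** * Periods and antiperiods of continuous functions *)

Section Periods.
Context {R : realType}.
Implicit Types (c d s t x y : R).

Lemma truncn_remainder t x : 0 < t -> 0 <= x ->
  0 <= x - t *+ Num.truncn (x / t) < t.
Proof.
move=> t0 x0; have /andP[] := truncn_itv (divr_ge0 x0 (ltW t0)).
rewrite ler_pdivlMr// ltr_pdivrMr// => h1; rewrite -natr1 => h2.
by rewrite -mulr_natl; lra.
Qed.

(** Any element [t] in the lowest occupied interval [N d, (N + 1) d) serves as generator. A nonzero
    remainder modulo [t] would also be at least N d, hence within [d] of [t], and the difference
    would be a forbidden small element. *)
Lemma discrete_subgroup_cyclic (P : R -> Prop) d s :
  (forall x y, P x -> P y -> P (x - y)) ->
  0 < d -> (forall t, 0 < t < d -> ~ P t) -> 0 < s -> P s ->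
  exists t, [/\ 0 < t, P t & forall x, P x -> 0 <= x -> exists n, x = t *+ n].
Proof.
move=> PB d0 Pd s0 Ps.
pose bucket n := `[< exists t, [/\ 0 < t, P t & Num.truncn (t / d) = n] >].
have exb : exists n, bucket n.
  by exists (Num.truncn (s / d)); apply/asboolP; exists s.
case: (ex_minnP exb) => N /asboolP[t [t0 Pt tN]] Nmin.
exists t; split => // x Px x0; exists (Num.truncn (x / t)).
have /andP[] := truncn_remainder t0 x0.
set n := Num.truncn _; set y := x - _ => y0 yt.
have Py : P y.
  rewrite /y; elim: (n) => [|k IH]; first by rewrite mulr0n subr0.
  by rewrite mulrSr opprD addrA; exact: PB.
move: y0; rewrite le_eqVlt => /predU1P[/esym/eqP|y0].
  by rewrite subr_eq0 => /eqP.
have Ny : (N <= Num.truncn (y / d))%N by apply: Nmin; apply/asboolP; exists y.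
exfalso; apply: (Pd (t - y)); last exact: PB.
have /andP[_ h1] := truncn_itv (divr_ge0 (ltW t0) (ltW d0)).
move: h1; rewrite tN ltr_pdivrMr// => h1.
have h2 : N%:R * d <= y.
  rewrite -ler_pdivlMr//; apply: le_trans (_ : (Num.truncn (y / d))%:R <= _).
    by rewrite ler_nat.
  by rewrite truncn_le divr_ge0 ?ltW.
by rewrite -natr1 in h1; lra.
Qed.

(** A small period carries [x] arbitrarily near [y] without changing the value of [g]; continuity at
    [y] concludes. *)
Lemma small_periods_constant (g : R -> R) : continuous g ->
  (forall d, 0 < d -> exists t, 0 < t < d /\ periodic g t) ->
  forall x y, g x = g y.
Proof.
move=> cg small.
suff H x y : x <= y -> g x = g y.
  by move=> x y; case: (leP x y) => [|/ltW] /H.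
move=> xy; apply/eqP; rewrite -subr_eq0 -normr_eq0 distrC; apply/negPn/negP => ne.
have e0 : 0 < `|g y - g x| by rewrite lt_neqAle eq_sym ne normr_ge0.
have /cvgrPdist_lt /(_ _ e0) /nbhs_ballP[d /= d0 hd] := cg y.
have [t [/andP[t0 td] gt]] := small d d0.
have := @truncn_remainder t (y - x) t0; rewrite subr_ge0 => /(_ xy).
set n := Num.truncn _ => /andP[h1 h2].
have := hd (x + t *+ n); rewrite -ball_normE/= (periodicn gt) ltxx => H.
suff: false by []; apply: H.
by rewrite ger0_norm; lra.
Qed.

(** If the group of periods and antiperiods is discrete, its generator cannot be a period, since [c]
    would be one too and [g] would vanish. So it is an antiperiod, with [c] an odd and [s] an even
    multiple. If the group is not discrete, [g] is constant, hence zero. *)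
Lemma alternating_periodic_ratio (g : R -> R) c s : continuous g ->
  0 < c -> 0 < s -> alternating g c -> periodic g s -> (exists x, g x != 0) ->
  exists m n : nat, [/\ odd m, (0 < n)%N & c *+ n.*2 = s *+ m].
Proof.
move=> cg c0 s0 gc gs [z gz].
pose P t := periodic g t \/ alternating g t.
have PB x y : P x -> P y -> P (x - y).
  have e u : g (u + x) = g (u + (x - y) + y) by congr g; ring.
  by case=> h1 [] h2; [left|right|right|left] => u; have := e u;
    rewrite h1 h2 => E; lra.
have [[d [d0 Pd]]|small] := pselect (exists d, 0 < d /\ forall t, 0 < t < d -> ~ P t).
  have [t [t0 Pt gen]] := discrete_subgroup_cyclic PB d0 Pd s0 (or_introl gs).
  have [m em] := gen _ (or_intror gc) (ltW c0).
  have [k ek] := gen _ (or_introl gs) (ltW s0).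
  case: Pt => gt.
    have := gc z; rewrite em periodicn// => /eqP.
    by rewrite -addr_eq0 -mulr2n mulrn_eq0/= (negbTE gz).
  have sgn j : g (z + t *+ j) = (-1) ^+ j * g z by rewrite alternatingn.
  have om : odd m.
    have := gc z; rewrite em sgn -signr_odd; case: odd => //.
    rewrite expr0 mul1r => /eqP.
    by rewrite -addr_eq0 -mulr2n mulrn_eq0/= (negbTE gz).
  have ok : ~~ odd k.
    have := gs z; rewrite ek sgn -signr_odd; case: odd => //.
    rewrite expr1 mulN1r => /eqP.
    by rewrite eq_sym -addr_eq0 -mulr2n mulrn_eq0/= (negbTE gz).
  have k2 : k./2.*2 = k by rewrite -[RHS]odd_double_half (negbTE ok).
  exists m, k./2; split => //.
    rewrite -double_gt0 k2 lt0n; apply/eqP => k0.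
    by move: s0; rewrite ek k0 mulr0n ltxx.
  by rewrite k2 em ek -!mulrnA mulnC.
have cst x y : g x = g y.
  apply: small_periods_constant => // d d0.
  have d20 : 0 < d / 2 by rewrite divr_gt0.
  (* Half of [d], because an antiperiod must be doubled to give a period. *)
  have [t [/andP[t0 td] Pt]] : exists t, 0 < t < d / 2 /\ P t.
    apply: contrapT => H; apply: small; exists (d / 2); split => // t td Pt.
    by apply: H; exists t.
  exists (t *+ 2); split; first by rewrite mulr2n; lra.
  by case: Pt => gt u; [exact: periodicn|rewrite alternatingn// sqrrN expr1n mul1r].
have := gc z; rewrite (cst _ z) => /eqP.
by rewrite -addr_eq0 -mulr2n mulrn_eq0/= (negbTE gz).
Qed.

End Periods.

(** * Support values of compact convex sets *)

Definition is_support {R : realType} (S : set (plane R)) (O : plane R) (t c : R) :=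
  (exists2 Q, S Q & dotp (Q - O) (udir t) = c) /\
  (forall X, S X -> dotp (X - O) (udir t) <= c).

Section Support.
Context {R : realType}.
Implicit Types (S : set (plane R)) (X Y Z Q O : plane R) (t r c k : R).

Lemma convex_setP S : convex_set S <->
  forall X Y k, S X -> S Y -> 0 <= k -> k <= 1 -> S (k *: X + (1 - k) *: Y).
Proof.
split=> [cS X Y k SX SY k0 k1|cS X Y k].
  by have := cS X Y (Itv01 k0 k1); rewrite !inE; exact.
by rewrite !inE => SX SY; apply: cS.
Qed.

Lemma continuous_dotp (f g : plane R -> plane R) :
  continuous f -> continuous g -> continuous (fun X => dotp (f X) (g X)).
Proof.
move=> cf cg X; apply: cvgD; apply: cvgM.
- by apply: cvg_comp (cf X) _; exact: cvg_fst.
- by apply: cvg_comp (cg X) _; exact: cvg_fst.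
- by apply: cvg_comp (cf X) _; exact: cvg_snd.
- by apply: cvg_comp (cg X) _; exact: cvg_snd.
Qed.

Lemma continuous_subl O : continuous (fun X : plane R => X - O).
Proof. by move=> X; apply: cvgB; [exact: cvg_id|exact: cvg_cst]. Qed.

Lemma continuous_dotp_sub O t : continuous (fun X => dotp (X - O) (udir t)).
Proof. by apply: continuous_dotp; [exact: continuous_subl|move=> ?; exact: cvg_cst]. Qed.

Lemma compact_shape S O r : closed S -> S `<=` disk O r -> compact S.
Proof.
move=> cS Sr.
apply: (@subclosed_compact _ S (`[O.1 - r, O.1 + r] `*` `[O.2 - r, O.2 + r])) => //.
  by apply: compact_setX; exact: segment_compact.
move=> X /Sr; rewrite /disk/= => h.
have r0 : 0 <= r by apply: le_trans h; exact: eucl_dist_ge0.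
move: h; rewrite eucl_dist_le// /dotp !planeE => h.
rewrite !in_itv/= -!ler_distl.
have abs (a b : R) : a * a + b * b <= r ^+ 2 -> `|a| <= r.
  move=> ab; rewrite -(@ler_pXn2r _ 2%N)// ?nnegrE// real_normK ?num_real//.
  by apply: le_trans ab; rewrite expr2 lerDl -expr2 sqr_ge0.
by split; [exact: abs h|apply: abs; rewrite addrC; exact: h].
Qed.

Lemma support_exists S O t : S !=set0 -> compact S -> exists c, is_support S O t c.
Proof.
move=> S0 cS.
have [|Q] := @compact_EVT_max _ _ (fun X => dotp (X - O) (udir t)) S S0 cS.
  by apply: continuous_subspaceT; exact: continuous_dotp_sub.
rewrite inE => SQ Qmax; exists (dotp (Q - O) (udir t)); split; first by exists Q.
by move=> X SX; apply: Qmax; rewrite inE.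
Qed.

(** Only directions are compared, so that angles differing by 2 pi get the same support value. *)
Lemma support_uniq S O t t' c c' : udir t = udir t' ->
  is_support S O t c -> is_support S O t' c' -> c = c'.
Proof.
move=> tt' [[Q SQ <-] Qm] [[Q' SQ' <-] Qm']; rewrite tt' in Qm *.
by apply/eqP; rewrite eq_le Qm// Qm'.
Qed.

(* The point of [S] nearest to [X] determines the separating direction. *)
Lemma separation S O X : S !=set0 -> compact S -> convex_set S -> ~ S X ->
  exists t c, is_support S O t c /\ c < dotp (X - O) (udir t).
Proof.
move=> S0 cS /convex_setP convS nSX.
have [|Y] := @compact_EVT_min _ _ (fun Z => dotp (Z - X) (Z - X)) S S0 cS.
  by apply: continuous_subspaceT; apply: continuous_dotp; exact: continuous_subl.
rewrite inE => SY Ymin.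
have obtuse Z : S Z -> dotp (Z - Y) (X - Y) <= 0.
  move=> SZ; rewrite leNgt; apply/negP => d0.
  set d := dotp _ _ in d0; pose n := dotp (Z - Y) (Z - Y).
  have n0 : 0 <= n by exact: dotp_ge0.
  (* Moving from [Y] towards [Z] by the fraction [k] changes the squared distance to [X] by - k (2 d
     - k n). This [k] is at most 1 and keeps k n <= d, so the distance decreases. *)
  pose k := d / (d + n).
  have dn0 : 0 < d + n by lra.
  have k0 : 0 < k by rewrite divr_gt0.
  have k1 : k <= 1 by rewrite ler_pdivrMr// mul1r lerDl.
  have := Ymin (k *: Z + (1 - k) *: Y); rewrite inE.
  move=> /(_ (convS _ _ _ SZ SY (ltW k0) k1)).
  have -> : dotp (k *: Z + (1 - k) *: Y - X) (k *: Z + (1 - k) *: Y - X) =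
    dotp (Y - X) (Y - X) - k * (2 * d - k * n).
    by rewrite /d /n /dotp !planeE; ring.
  suff : 0 < k * (2 * d - k * n) by lra.
  rewrite mulr_gt0// subr_gt0.
  have : k * n <= d by rewrite /k mulrAC ler_pdivrMr// ler_pM2l// lerDr ltW.
  lra.
have [k [t [k0 e]]] := polar (X - Y).
have {}k0 : 0 < k.
  rewrite lt_neqAle k0 andbT eq_sym; apply/eqP => k00; apply: nSX.
  by move/eqP: e; rewrite k00 scale0r subr_eq0 => /eqP ->.
exists t, (dotp (Y - O) (udir t)); split; last first.
  rewrite -subr_gt0 -dotpBl opprB addrA subrK e dotpZl dotp_udir subrr cos0.
  by rewrite mulr1.
split=> [|Z /obtuse]; first by exists Y.
have -> : dotp (Z - Y) (X - Y) = k * dotp (Z - Y) (udir t).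
  by rewrite e /dotp !planeE; ring.
rewrite pmulr_rle0//.
have -> : dotp (Z - Y) (udir t) = dotp (Z - O) (udir t) - dotp (Y - O) (udir t).
  by rewrite -dotpBl opprB addrA subrK.
by rewrite subr_le0.
Qed.

(** A point of [S] is tested in its own direction from [O]. A point of the disk outside [S] would be
    cut off by a supporting line at distance [c], against Cauchy-Schwarz. *)
Lemma constant_support_disk S O c : 0 <= c -> S !=set0 -> compact S ->
  convex_set S -> (forall t, is_support S O t c) -> S = disk O c.
Proof.
move=> c0 S0 cS convS sup; apply/seteqP; split=> X; rewrite /disk/= eucl_dist_le//.
  move=> SX; have [k [t [k0 e]]] := polar (X - O).
  have := (sup t).2 X SX; rewrite e dotpZl dotp_udir subrr cos0 mulr1 => kc.
  rewrite /dotp !planeE.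
  have -> : k * cos t * (k * cos t) + k * sin t * (k * sin t) = k ^+ 2.
    by have e' := sin2cos2 t; ring: e'.
  by rewrite ler_pXn2r// nnegrE.
move=> Xc; apply: contrapT => nSX.
have [t [c' [supc' lt]]] := separation O S0 cS convS nSX.
move: lt; rewrite (support_uniq erefl supc' (sup t)) ltNge => /negP; apply.
exact: dotp_le_norm.
Qed.

(** The contact point for [t] competes in the maximum for [t'], and its coordinates are bounded by
    [r]; hence a Lipschitz bound in terms of cos and sin. *)
Lemma continuous_support S O r (h : R -> R) : S `<=` disk O r ->
  (forall t, is_support S O t (h t)) -> continuous h.
Proof.
move=> Sr sup.
have lip t t' : h t <= h t' + r * (`|cos t - cos t'| + `|sin t - sin t'|).
  have [[Q SQ <-] _] := sup t.
  have Qr := Sr _ SQ; rewrite /disk/= in Qr.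
  have r0 : 0 <= r by apply: le_trans Qr; exact: eucl_dist_ge0.
  move: Qr; rewrite eucl_dist_le// => Qr.
  have hQ := (sup t').2 _ SQ.
  (* The four axis directions bound both coordinates of [Q - O] by [r]. *)
  have /= b1 := dotp_le_norm 0 r0 Qr; have /= b2 := dotp_le_norm pi r0 Qr.
  have b3 := dotp_le_norm (pi / 2) r0 Qr; have b4 := dotp_le_norm (- (pi / 2)) r0 Qr.
  move: b1 b2 b3 b4 hQ; rewrite /dotp !planeE cos0 sin0 cospi sinpi cosN sinN cos_pihalf sin_pihalf.
  set x := _ - _; set y := _ - _; rewrite !mulr0 !mulr1 !addr0 !add0r => b1 b2 b3 b4 hQ.
  have ax : `|x| <= r by rewrite ler_norml; lra.
  have ay : `|y| <= r by rewrite ler_norml; lra.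
  have : x * (cos t - cos t') <= r * `|cos t - cos t'|.
    by apply: le_trans (ler_norm _) _; rewrite normrM ler_wpM2r.
  have : y * (sin t - sin t') <= r * `|sin t - sin t'|.
    by apply: le_trans (ler_norm _) _; rewrite normrM ler_wpM2r.
  lra.
move=> t; apply/cvgrPdist_lt => e e0.
have : (fun s => r * (`|cos t - cos s| + `|sin t - sin s|)) s @[s --> t] -->
    r * (`|cos t - cos t| + `|sin t - sin t|).
  apply: cvgMr; apply: cvgD; apply: cvg_norm; apply: cvgB; try exact: cvg_cst.
    exact: continuous_cos.
  exact: continuous_sin.
rewrite !subrr normr0 addr0 mulr0 => /cvgrPdist_lt /(_ e e0).
apply: filterS => s; rewrite sub0r normrN => hs.
rewrite ltr_norml; have h1 := lip t s; have h2 := lip s t.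
rewrite (distrC (cos s)) (distrC (sin s)) in h2.
move: hs; rewrite ltr_norml => /andP[_ hs]; lra.
Qed.

End Support.

(** * From a constant angle to a rational multiple of pi *)

Section Forward.
Context {R : realType}.
Implicit Types (S : set (plane R)) (X Y Z P Q O : plane R) (t r c k : R).

Lemma circle_point O r t : 0 < r -> circle O r (O + r *: udir t).
Proof.
move=> r0; rewrite /circle/= /Defs.edist !planeE.
have -> : ((O.1 : R) + r * cos t - O.1) ^+ 2 + ((O.2 : R) + r * sin t - O.2) ^+ 2 = r ^+ 2.
  by have e := sin2cos2 t; ring: e.
by rewrite sqrtr_sqr gtr0_norm.
Qed.

Lemma inside_dist O r a S X : constant_angle_shape O r a S -> S X ->
  Defs.edist X O < r.
Proof.
move=> [_ Sr Sc _] SX; rewrite lt_neqAle (Sr X SX) andbT.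
by apply/eqP => e; suff: (set0 : set (plane R)) X by []; rewrite -Sc.
Qed.

(** The contact point is tested in the directions [t] and [t + pi]. Strictness keeps the angle
    [acos (h t / r)] away from 0 and pi. *)
Lemma support_lt O r a S t c : constant_angle_shape O r a S ->
  is_support S O t c -> -1 < c / r < 1.
Proof.
move=> shS [[Q SQ <-] _].
have Qr := inside_dist shS SQ; have d0 := eucl_dist_ge0 Q O.
have r0 : 0 < r by apply: le_lt_trans Qr.
have h1 := @dotp_le_norm _ (Q - O) t _ d0; have h2 := @dotp_le_norm _ (Q - O) (t + pi) _ d0.
move: h1 h2; rewrite -eucl_distE => /(_ (lexx _)) h1 /(_ (lexx _)).
have -> : dotp (Q - O) (udir (t + pi)) = - dotp (Q - O) (udir t).
  by rewrite /dotp/= cosDpi sinDpi; ring.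
by rewrite ltr_pdivlMr// ltr_pdivrMr// => h2; lra.
Qed.

(* From a point [P] of the circle, the two sides of the cone of sight are
   supporting lines. The one with outer normal [t] makes an angle [b] with the
   radius [OP]; the other one then has outer normal [t + pi - a] and makes the
   angle [pi - a - b] with [OP]. *)
Lemma opposite_tangent O r a S t b : 0 < r -> 0 < a < pi ->
  constant_angle_shape O r a S -> 0 < b < pi -> is_support S O t (r * cos b) ->
  b < pi - a /\ is_support S O (t + (pi - a)) (r * cos (pi - a - b)).
Proof.
move=> r0 apos shS /andP[b0 bpi] [[Q SQ Qb] Sb]; have [a0 api] := andP apos.
have sa : 0 < sin a by rewrite sin_gt0_pi// a0.
have sb : 0 < sin b by rewrite sin_gt0_pi// b0.
pose P := O + r *: udir (t + b).
have [_ _ [s coneE]] : angle_of_sight P S a by case: shS => _ _ _; apply; exact: circle_point.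
have sect X : S X -> exists a1 a2,
    [/\ 0 <= a1, 0 <= a2 & X - P = a1 *: udir s + a2 *: udir (s + a)].
  move=> SX; have : sight_cone P S X.
    by exists X => //; exists 1; rewrite /= ?ler01// scale1r addrC subrK.
  rewrite coneE => /sectorP-/(_ apos)[a1 [a2 [a10 a20 ->]]].
  by exists a1, a2; rewrite addrAC subrr add0r.
(* The cone is generated by [S], so each direction of the sector is realized by a point of [S]. *)
have side u : sector P s a (P + udir u) -> exists X k, [/\ S X, 0 < k & X - P = k *: udir u].
  rewrite -coneE => -[X SX [k /= k0 /addrI e]]; exists X, k^-1; split => //.
    rewrite invr_gt0 lt_neqAle k0 andbT; apply/eqP => k00.
    have : dotp (udir u) (udir u) = 0 by rewrite -e -k00 scale0r /dotp !planeE; ring.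
    by rewrite dotp_udir subrr cos0 => /eqP; rewrite oner_eq0.
  rewrite -e scalerA mulVf ?scale1r//; apply/eqP => k00.
  have : dotp (udir u) (udir u) = 0 by rewrite -e k00 scale0r /dotp !planeE; ring.
  by rewrite dotp_udir subrr cos0 => /eqP; rewrite oner_eq0.
have [X1 [k1 [SX1 k10 e1]]] : exists X k, [/\ S X, 0 < k & X - P = k *: udir s].
  apply: side; apply/sectorP => //; exists 1, 0.
  by rewrite ler01 lexx scale0r scale1r addr0.
have [X2 [k2 [SX2 k20 e2]]] : exists X k, [/\ S X, 0 < k & X - P = k *: udir (s + a)].
  apply: side; apply/sectorP => //; exists 0, 1.
  by rewrite ler01 lexx scale0r scale1r add0r.
have shift X u : dotp (X - O) (udir u) = dotp (X - P) (udir u) + r * cos (t + b - u).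
  by rewrite /P /dotp !planeE cosB; ring.
have tb : t + b - t = b by ring.
have below X : S X -> dotp (X - P) (udir t) <= 0.
  by move=> /Sb; rewrite shift tb; lra.
(* A point strictly inside the circle is strictly on the inner side of the tangent to the circle at
   [P]. *)
have inner X : S X -> dotp (X - P) (udir (t + b)) < 0.
  move=> SX; have := inside_dist shS SX; rewrite eucl_dist_lt ?(ltW r0)//.
  have -> : dotp (X - O) (X - O) = dotp (X - P) (X - P) +
      2 * r * dotp (X - P) (udir (t + b)) + r ^+ 2.
    by rewrite /P /dotp !planeE; have e := sin2cos2 (t + b); ring: e.
  have := dotp_ge0 (X - P) => n0 h.
  have : 2 * r * dotp (X - P) (udir (t + b)) < 0 by lra.
  by rewrite pmulr_rlt0// mulr_gt0.
have [d ed] : exists d, d = s - t by exists (s - t).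
have c1 : cos d <= 0.
  by move: (below _ SX1); rewrite e1 dotpZl dotp_udir -ed pmulr_rle0.
have c2 : cos (d + a) <= 0.
  by move: (below _ SX2); rewrite e2 dotpZl dotp_udir addrAC -ed pmulr_rle0.
have c3 : cos (d - b) < 0.
  by move: (inner _ SX1); rewrite e1 dotpZl dotp_udir opprD addrA -ed pmulr_rlt0.
have [a1 [a2 [a10 a20 eQ]]] := sect _ SQ.
have touch : a1 * cos d + a2 * cos (d + a) = 0.
  have : dotp (Q - P) (udir t) = 0 by move: Qb; rewrite shift tb; lra.
  by rewrite eQ dotpDl !dotpZl !dotp_udir [s + a - t]addrAC -ed.
have Qne : ~ (a1 = 0 /\ a2 = 0).
  move=> [z1 z2]; move: (inner _ SQ); rewrite eQ z1 z2 !scale0r addr0.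
  by rewrite /dotp !planeE !mul0r addr0 ltxx.
(* Otherwise cos (d + a) < 0, and the contact at [Q] forces cos d = 0; then cos (d + a) < 0 and cos
   (d - b) < 0 give sin d opposite signs. So it is the side [s + a] that lies on the given
   supporting line. *)
have cda : cos (d + a) = 0.
  apply/eqP; apply: contrapT => /negP/negbTE nz.
  have cneg : cos (d + a) < 0 by rewrite lt_neqAle nz.
  have cd0 : cos d = 0.
    apply/eqP; apply: contrapT => /negP/negbTE nz'; apply: Qne.
    have cneg' : cos d < 0 by rewrite lt_neqAle nz'.
    have p1 : a1 * cos d <= 0 by rewrite mulr_ge0_le0.
    have p2 : a2 * cos (d + a) <= 0 by rewrite mulr_ge0_le0.
    have /eqP : a1 * cos d = 0 by lra.
    have /eqP : a2 * cos (d + a) = 0 by lra.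
    by rewrite !mulf_eq0 nz nz' !orbF => /eqP -> /eqP ->.
  move: cneg c3; rewrite cosD cosB cd0 !mul0r sub0r add0r oppr_lt0 pmulr_lgt0// => h.
  by rewrite pmulr_llt0// ltNge (ltW h).
have sda : sin (d + a) = -1.
  have h : sin (d + a) <= 0.
    move: c1; rewrite -[d in cos d](addrK a) cosB cda mul0r add0r.
    by rewrite pmulr_lle0.
  have := sin2cos2 (d + a); rewrite cda expr0n/= subr0 => /eqP.
  by rewrite sqrf_eq1 => /orP[/eqP h1|/eqP//]; move: h; rewrite h1 ler10.
have bpa : b < pi - a.
  rewrite ltNge; apply/negP => h; move: c3.
  rewrite -[d](addrK a) -addrA -opprD cosB cda sda mul0r add0r mulN1r oppr_lt0.
  have -> : a + b = (a + b - pi) + pi by rewrite subrK.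
  by rewrite sinDpi oppr_gt0 ltNge sin_ge0_pi//; lra.
(* Along the normal [t + (pi - a)] only the coordinate [v] counts, so the side v = 0 of the cone
   lies on the other supporting line. *)
have bq X u v : X - P = u *: udir s + v *: udir (s + a) ->
    dotp (X - O) (udir (t + (pi - a))) = r * cos (pi - a - b) - v * sin a.
  move=> e; rewrite shift e dotpDl !dotpZl !dotp_udir.
  have -> : s - (t + (pi - a)) = (d + a) - pi by rewrite ed; ring.
  have -> : s + a - (t + (pi - a)) = (d + a) + a - pi by rewrite ed; ring.
  have -> : t + b - (t + (pi - a)) = - (pi - a - b) by ring.
  rewrite cosN !cosB cospi sinpi [cos (d + a + a)]cosD cda sda; ring.
split => //; split=> [|X /sect[u [v [u0 v0 e]]]].
  exists X1 => //; rewrite (bq X1 k1 0) ?mul0r ?subr0//.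
  by rewrite e1 scale0r addr0.
by rewrite (bq X u v)// gerBl mulr_ge0// ltW.
Qed.


(** Writing n - m = p d and n = q d with [d] the gcd leaves m = (q - p) d, and a divisor of an odd
    number is odd. *)
Lemma reduced_ratio (m n : nat) : odd m -> (m < n)%N ->
  exists p q : nat, [/\ (0 < p < q)%N, coprime p q, odd (q - p) &
    (n - m)%:R / n%:R = p%:R / q%:R :> R].
Proof.
move=> om mn; pose d := gcdn (n - m) n.
have n0 : (0 < n)%N by case: n mn {d}.
have d0 : (0 < d)%N by rewrite gcdn_gt0 n0 orbT.
have [ep eq] : (n - m = (n - m) %/ d * d)%N /\ (n = n %/ d * d)%N.
  by rewrite !divnK ?dvdn_gcdl ?dvdn_gcdr.
set p := (_ %/ d)%N in ep; set q := (_ %/ d)%N in eq.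
have em : (m = (q - p) * d)%N by rewrite mulnBl -ep -eq subKn// ltnW.
exists p, q; split.
- have m0 : (0 < m)%N by case: m om {mn d d0 ep p em q eq}.
  by rewrite -(ltn_pmul2r d0) -[(p < q)%N](ltn_pmul2r d0) mul0n -ep -eq subn_gt0 mn ltn_subrL m0.
- by rewrite /coprime -(eqn_pmul2r d0) muln_gcdl -ep -eq mul1n.
- by move: om; rewrite em oddM => /andP[].
- rewrite ep [in X in _ / X]eq !natrM -mulf_div divff ?mulr1// pnatr_eq0 -lt0n//.
Qed.

Lemma nondisk_angle O r a S : 0 < r -> 0 < a < pi ->
  constant_angle_shape O r a S -> ~ is_disk S ->
  exists p q : nat, [/\ (0 < p < q)%N, coprime p q, odd (q - p) &
    a = p%:R / q%:R * pi].
Proof.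
move=> r0 apos shS ndS; have [a0 api] := andP apos.
have [[clS cvS] Sr _ sight] := shS.
have cS : compact S := compact_shape clS Sr.
have S0 : S !=set0.
  apply/set0P/eqP => S0; have [_ _ [s]] := sight _ (circle_point O 0 r0).
  rewrite S0 /sight_cone bigcup_set0 => /esym e.
  suff : (set0 : set (plane R)) (O + r *: udir 0) by [].
  by rewrite -e; apply/sectorP => //; exists 0, 0; rewrite !scale0r !addr0.
have [h hS] := choice (fun t => support_exists O t S0 cS).
pose b t := acos (h t / r); pose c := pi - a.
have hr t : -1 < h t / r < 1 := support_lt shS (hS t).
have bpos t : 0 < b t < pi.
  by have /andP[h1 h2] := hr t; rewrite acos_gt0 ?acos_ltpi// ?h1 ?h2 ltW.
have hb t : h t = r * cos (b t).
  have /andP[h1 h2] := hr t.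
  by rewrite acosK ?in_itv/= ?(ltW h1) ?(ltW h2)// mulrC divfK// gt_eqF.
have bc t : b (t + c) = c - b t.
  have hSt := hS t; rewrite hb in hSt.
  have [bt sup] := opposite_tangent r0 apos shS (bpos t) hSt.
  have := support_uniq erefl (hS (t + c)) sup; rewrite hb => /(mulfI _).
  rewrite gt_eqF// => /(_ isT); apply: cos_inj; rewrite in_itv/=.
    by have /andP[h1 h2] := bpos (t + c); rewrite !ltW.
  by have /andP[h1 h2] := bpos t; rewrite /c; apply/andP; split; lra.
pose g t := b t - c / 2.
have cg : continuous g.
  move=> t; apply: cvgB; last exact: cvg_cst.
  have ch : {for t, continuous (fun s => h s / r)}.
    by apply: cvgMl; exact: (continuous_support Sr hS).
  exact: (continuous_comp ch (continuous_acos (hr t))).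
have gc : alternating g c by move=> t; rewrite /g bc; lra.
have gp : periodic g (pi *+ 2).
  move=> t; rewrite /g /b; congr (acos (_ / _) - _).
  by apply: support_uniq (hS _) (hS _); rewrite /udir cosD2pi sinD2pi.
have c0 : 0 < c by rewrite subr_gt0.
have p2 : 0 < (pi : R) *+ 2 by rewrite mulrn_wgt0// pi_gt0.
have [|m [n [om n0]]] := alternating_periodic_ratio cg c0 p2 gc gp.
  (* If [g] vanishes identically, [S] is a disk about [O]; its radius is positive because c / 2 < pi
     / 2. *)
  apply: contrapT => nex; apply: ndS; exists O, (r * cos (c / 2)).
  have c2 : 0 < cos (c / 2).
    by rewrite cos_gt0_pihalf// /c; apply/andP; split; lra.
  split; first by rewrite mulr_gt0.
  apply: constant_support_disk => //; first by rewrite ltW// mulr_gt0.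
  move=> t; suff <- : h t = r * cos (c / 2) by [].
  rewrite hb; congr (_ * cos _); apply/eqP; rewrite -subr_eq0.
  by apply/negPn/negP => nz; apply: nex; exists t.
move=> E; have {E} e : c *+ n = pi *+ m.
  by move: E; rewrite -muln2 mulrnA [pi *+ 2 *+ m]mulrnAC !mulr2n; lra.
have mn : (m < n)%N.
  rewrite -(@ltr_nat R) -(ltr_pM2l (pi_gt0 R)) !mulr_natr -e.
  by rewrite ltr_pMn2r// /c ltrBlDr ltrDl.
(* From c = (m / n) pi the angle is a = ((n - m) / n) pi. *)
have [p [q [pq cpq opq epq]]] := reduced_ratio om mn.
exists p, q; split => //; rewrite -epq natrB; last exact: ltnW.
have nR : (n%:R : R) != 0 by rewrite pnatr_eq0 -lt0n.
apply: (mulIf nR); rewrite mulrAC divfK// mulrBl.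
move: e; rewrite -mulr_natr -[pi *+ m]mulr_natr /c; lra.
Qed.

End Forward.

(** * Intersections of half-planes with a prescribed support function *)

Definition shape_of_support {R : realType} (O : plane R) (h : R -> R) : set (plane R) :=
  [set X | forall t, dotp (X - O) (udir t) <= h t].

Section Backward.
Context {R : realType}.
Implicit Types (S : set (plane R)) (X Y Z P Q O : plane R) (t r c k : R).
Implicit Types (b h : R -> R).

Lemma shape_of_support_convex O h : convex_shape (shape_of_support O h).
Proof.
split; last first.
  apply/convex_setP => X Y k SX SY k0 k1 t.
  have -> : dotp (k *: X + (1 - k) *: Y - O) (udir t) =
    k * dotp (X - O) (udir t) + (1 - k) * dotp (Y - O) (udir t).
    by rewrite /dotp !planeE; ring.
  have := ler_wpM2l k0 (SX t); have k10 : 0 <= 1 - k by lra.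
  have := ler_wpM2l k10 (SY t); lra.
have -> : shape_of_support O h =
    \bigcap_t ((fun X => dotp (X - O) (udir t)) @^-1` [set x | x <= h t]).
  by apply/seteqP; split=> X hX t; [move=> _|]; exact: hX.
apply: closed_bigI => t _; apply: closed_comp; last exact: closed_le.
by move=> X _; exact: continuous_dotp_sub.
Qed.

(** An integer multiple of [s] is written as a difference of natural multiples, the form to which
    [periodicn] applies. *)
Lemma periodic_shift (f : R -> R) s : 0 < s -> periodic f s ->
  forall x y, exists z, y <= z < y + s /\ exists n k : nat, z + s *+ n = x + s *+ k.
Proof.
move=> s0 fs x y; pose k := (Num.truncn (`|y - x| / s)).+1.
have hk : y <= x + s *+ k.
  have := truncnS_gt (`|y - x| / s); rewrite ltr_pdivrMr// mulr_natl -/k.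
  by have := ler_norm (y - x); lra.
have := @truncn_remainder R s (x + s *+ k - y) s0; rewrite subr_ge0 => /(_ hk).
set n := Num.truncn _ => /andP[h1 h2].
exists (x + s *+ k - s *+ n); split; first by apply/andP; split; lra.
by exists n, k; rewrite subrK.
Qed.

Section Smooth.
Variables (h h1 h2 : R -> R).
Hypothesis dh : forall t, is_derive t 1 h (h1 t).
Hypothesis dh1 : forall t, is_derive t 1 h1 (h2 t).
Hypothesis curv : forall t, 0 <= h t + h2 t.

(** The component along [udir s] of h x udir x + h1 x udir (x + pi / 2), the expected boundary point
    with outer normal [x]. *)
Let G (s x : R) : R := h x * cos (s - x) + h1 x * sin (s - x).

Let dG (s x : R) : is_derive x 1 (G s) ((h x + h2 x) * sin (s - x)).
Proof.
have d0 : is_derive x 1 (fun y => s - y) (-1).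
  by apply: is_derive_eq; rewrite add0r mul1r.
have dc : is_derive x 1 (fun y => cos (s - y)) (sin (s - x)).
  have -> : sin (s - x) = - sin (s - x) * -1 by ring.
  exact: (@is_derive1_comp _ cos (fun y => s - y) x _ _ (is_derive_cos (s - x)) d0).
have ds : is_derive x 1 (fun y => sin (s - y)) (- cos (s - x)).
  have -> : - cos (s - x) = cos (s - x) * -1 by ring.
  exact: (@is_derive1_comp _ sin (fun y => s - y) x _ _ (is_derive_sin (s - x)) d0).
apply: (@is_derive_eq _ _ _ _ _ _ _ _
  (is_deriveD (is_deriveM (dh x) dc) (is_deriveM (dh1 x) ds))).
by rewrite /GRing.scale/=; ring.
Qed.

Let cG (s : R) : continuous (G s).
Proof.
move=> x; apply/differentiable_continuous/derivable1_diffP.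
by have [] := dG s x.
Qed.

(** The derivative of [G s] at x is the radius of curvature h + h2, which is nonnegative, times sin
    (s - x). By the mean value theorem, within half a turn on either side, [G s] is at most its
    value at [s], which is [h s]. *)
Lemma tangent_below s t : t - pi <= s <= t + pi ->
  h t * cos (s - t) + h1 t * sin (s - t) <= h s.
Proof.
move=> /andP[tps stp]; have e : h s = G s s.
  by rewrite /G subrr cos0 sin0 mulr1 mulr0 addr0.
rewrite e -/(G s t) -subr_ge0; have [ts|st] := leP t s.
  have [x xts ->] := MVT_segment ts (fun x _ => dG s x) (continuous_subspaceT (@cG s)).
  move: xts; rewrite in_itv/= => /andP[h3 h4].
  by rewrite !mulr_ge0 ?subr_ge0// sin_ge0_pi//; apply/andP; split; lra.
have [x xts] := MVT_segment (ltW st) (fun x _ => dG s x) (continuous_subspaceT (@cG s)).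
move: xts; rewrite in_itv/= => /andP[h3 h4].
rewrite -opprB => /(congr1 -%R); rewrite opprK => ->.
rewrite -mulNr -mulrN -sinN opprB !mulr_ge0 ?subr_ge0 ?(ltW st)// sin_ge0_pi//.
by apply/andP; split; lra.
Qed.

Lemma smooth_support O : periodic h (pi *+ 2) ->
  forall t, is_support (shape_of_support O h) O t (h t).
Proof.
move=> hper t; split; last by move=> X; exact.
(* The point where the line with normal [t] touches the envelope of all these lines. *)
exists (O + (h t *: udir t + h1 t *: udir (t + pi / 2))).
  move=> s; have p2 : 0 < (pi : R) *+ 2 by rewrite mulrn_wgt0// pi_gt0.
  (* Periodicity replaces [s] by an angle within pi of [t], where [tangent_below] applies. *)
  have [z [/andP[z1 z2] [n [k znk]]]] := periodic_shift p2 hper s (t - pi).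
  have -> : h s = h z by rewrite -(periodicn hper n z) znk periodicn.
  have -> : udir s = udir z.
    rewrite /udir -(periodicn (@cosD2pi R) n z) -(periodicn (@sinD2pi R) n z).
    by rewrite znk !periodicn//; [exact: sinD2pi|exact: cosD2pi].
  apply: le_trans (@tangent_below z t _); last by rewrite z1/=; lra.
  rewrite addrAC subrr add0r dotpDl !dotpZl !dotp_udir [t + _ - z]addrAC cosDpihalf.
  by rewrite -[t - z]opprB cosN sinN opprK.
rewrite addrAC subrr add0r dotpDl !dotpZl !dotp_udir subrr cos0 [t + _ - t]addrAC.
by rewrite subrr add0r cos_pihalf mulr0 addr0 mulr1.
Qed.

End Smooth.

End Backward.

(** * The functional equation yields a constant angle of sight *)

Section Sight.
Context {R : realType}.
Implicit Types (S : set (plane R)) (v X Y Z P Q O : plane R) (t s r c k a : R).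
Implicit Types (b h : R -> R).

(** Cramer's rule in the basis of the two sides of the cone, which are perpendicular to the outer
    normals [t + (pi - a)] and [t] respectively. *)
Lemma tangent_coordinates v t a : sin a *: v =
  (- dotp v (udir t)) *: udir (t - a - pi / 2) +
  (- dotp v (udir (t + (pi - a)))) *: udir (t - pi / 2).
Proof.
have -> : t + (pi - a) = t - a + pi by ring.
have e := sin2cos2 t; apply: planeP; rewrite /dotp !planeE;
 rewrite !(cosBpihalf, sinBpihalf) cosDpi sinDpi !(cosB, sinB); ring: e.
Qed.

Section Construction.
Variables (O : plane R) (r a : R) (b : R -> R).
Hypotheses (r0 : 0 < r) (apos : 0 < a < pi) (cb : continuous b).
Hypothesis bpos : forall t, 0 < b t < pi - a.
Hypothesis b_opp : forall t, b (t + (pi - a)) = pi - a - b t.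
Let S := shape_of_support O (fun t => r * cos (b t)).
Hypothesis supS : forall t, is_support S O t (r * cos (b t)).

Let inside X : S X -> Defs.edist X O < r.
Proof.
move=> SX; have [k [t [k0 e]]] := polar (X - O).
have := SX t; rewrite e dotpZl dotp_udir subrr cos0 mulr1 => kc.
have /andP[b0 bpi] := bpos t; have [a0 api] := andP apos.
have c1 : cos (b t) < 1.
  by rewrite -cos0 ltr_cos// in_itv/=; apply/andP; split; lra.
have kr : k < r by apply: le_lt_trans kc _; rewrite gtr_pMr.
rewrite eucl_dist_lt ?(ltW r0)// e /dotp !planeE.
have -> : k * cos t * (k * cos t) + k * sin t * (k * sin t) = k ^+ 2.
  by have e' := sin2cos2 t; ring: e'.
by rewrite ltr_pXn2r// nnegrE// ltW.
Qed.

Let circle_polar P : circle O r P -> exists s, P = O + r *: udir s.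
Proof.
rewrite /circle/= => Pr; have [k [s [k0 e]]] := polar (P - O).
exists s; suff <- : k = r by rewrite -e addrC subrK.
apply/eqP; rewrite -(@eqrXn2 _ 2%N)// ?(ltW r0)// -Pr eucl_distE e /dotp !planeE.
by apply/eqP; have e' := sin2cos2 s; ring: e'.
Qed.

(** Since 0 < b < pi, [t + b t] is below [s] at [s - pi] and above [s] at [s]. This gives each point
    of the circle a supporting line through it. *)
Let tangent_direction s : exists t, t + b t = s.
Proof.
have cf : continuous (fun t => t + b t).
  by move=> t; apply: cvgD; [exact: cvg_id|exact: cb].
have [a0 api] := andP apos.
have le : s - pi <= s by have := pi_gt0 R; lra.
have [|t _ ts] := IVT (v := s) le (continuous_subspaceT cf); last by exists t.
have /andP[b1 b2] := bpos (s - pi); have /andP[b3 b4] := bpos s.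
by rewrite ge_min le_max; apply/andP; split; apply/orP; [left|right]; lra.
Qed.

(** The supporting lines with normals [t] and [t'] both pass through [P], so the cone of sight lies
    in the sector between them. Their contact points [Q1] and [Q2] lie on the two sides of the
    sector and, by convexity, generate all of it. *)
Lemma constant_angle_of_support : constant_angle_shape O r a S.
Proof.
have [a0 api] := andP apos.
have sa : 0 < sin a by rewrite sin_gt0_pi// a0.
split.
- exact: shape_of_support_convex.
- by move=> X /inside/ltW.
- by apply/seteqP; split=> // X [/inside /=]; rewrite /circle/= => /[swap] ->; rewrite ltxx.
move=> P Pr.
have PnS : ~ S P by move=> /inside; rewrite Pr ltxx.
have [s eP] := circle_polar Pr; have [t ts] := tangent_direction s.
pose t' := t + (pi - a); have [_ below] := supS t; have [_ below'] := supS t'.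
have shift X u : dotp (X - P) (udir u) = dotp (X - O) (udir u) - r * cos (s - u).
  by rewrite eP /dotp !planeE cosB; ring.
have st : cos (s - t) = cos (b t) by rewrite -ts addrAC subrr add0r.
have st' : cos (s - t') = cos (b t').
  by rewrite /t' b_opp -[RHS]cosN -ts; congr cos; ring.
have dP X : S X -> 0 <= - dotp (X - P) (udir t).
  by move=> SX; rewrite shift st oppr_ge0 subr_le0 below.
have dP' X : S X -> 0 <= - dotp (X - P) (udir t').
  by move=> SX; rewrite shift st' oppr_ge0 subr_le0 below'.
have coord X : X - P =
    (- dotp (X - P) (udir t) / sin a) *: udir (t - a - pi / 2) +
    (- dotp (X - P) (udir t') / sin a) *: udir (t - pi / 2).
  rewrite ![_ / sin a]mulrC -!scalerA -scalerDr -tangent_coordinates.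
  by rewrite scalerA mulVf ?scale1r// gt_eqF.
have et : t - a - pi / 2 + a = t - pi / 2 by ring.
have XneP X : S X -> X - P != 0.
  by move=> SX; rewrite subr_eq0; apply/eqP => XP; apply: PnS; rewrite -XP.
have [Q1 [k1 [SQ1 k10 e1]]] : exists Q k,
    [/\ S Q, 0 < k & Q - P = k *: udir (t - pi / 2)].
  have [[Q SQ Qt] _] := supS t.
  have e := coord Q; rewrite {1}shift st Qt subrr oppr0 mul0r scale0r add0r in e.
  exists Q, (- dotp (Q - P) (udir t') / sin a); split => //.
  rewrite lt_neqAle divr_ge0 ?dP' ?(ltW sa)// andbT eq_sym.
  by apply: contra (XneP _ SQ) => /eqP z; rewrite e z scale0r.
have [Q2 [k2 [SQ2 k20 e2]]] : exists Q k,
    [/\ S Q, 0 < k & Q - P = k *: udir (t - a - pi / 2)].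
  have [[Q SQ Qt] _] := supS t'.
  have e := coord Q; rewrite [dotp _ (udir t')]shift st' Qt subrr oppr0 mul0r scale0r addr0 in e.
  exists Q, (- dotp (Q - P) (udir t) / sin a); split => //.
  rewrite lt_neqAle divr_ge0 ?dP ?(ltW sa)// andbT eq_sym.
  by apply: contra (XneP _ SQ) => /eqP z; rewrite e z scale0r.
split; [by apply/negP; rewrite inE|lra|].
exists (t - a - pi / 2); apply/seteqP; split=> X.
  move=> [Q SQ [k /= k0 <-]]; apply/sectorP => //.
  exists (k * (- dotp (Q - P) (udir t) / sin a)), (k * (- dotp (Q - P) (udir t') / sin a)).
  split; first by rewrite mulr_ge0// divr_ge0 ?dP// ltW.
    by rewrite mulr_ge0// divr_ge0 ?dP'// ltW.
  by rewrite et; congr (_ + _); rewrite [in LHS](coord Q) scalerDr !scalerA.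
move=> /sectorP-/(_ apos)[x1 [x2 [x10 x20 ->]]]; rewrite et.
have [y1 [y10 ->]] : exists y, 0 <= y /\ x1 *: udir (t - a - pi / 2) = y *: (Q2 - P).
  exists (x1 / k2); rewrite divr_ge0 ?(ltW k20)// e2 scalerA divfK// gt_eqF//.
have [y2 [y20 ->]] : exists y, 0 <= y /\ x2 *: udir (t - pi / 2) = y *: (Q1 - P).
  exists (x2 / k1); rewrite divr_ge0 ?(ltW k10)// e1 scalerA divfK// gt_eqF//.
have := addr_ge0 y10 y20; rewrite le_eqVlt => /predU1P[/esym/eqP|y0].
  rewrite paddr_eq0// => /andP[/eqP -> /eqP ->].
  by exists Q1 => //; exists 0; rewrite /= ?lexx// !scale0r !addr0.
(* Dividing by the total weight brings the point onto the segment from [Q1] to [Q2]. *)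
exists ((y1 / (y1 + y2)) *: Q2 + (1 - y1 / (y1 + y2)) *: Q1).
  have /convex_setP := (shape_of_support_convex O (fun t => r * cos (b t))).2.
  apply => //; first by rewrite divr_ge0// ltW.
  by rewrite ler_pdivrMr// mul1r lerDl.
exists (y1 + y2); first exact: ltW.
have ny : y1 + y2 != 0 by rewrite gt_eqF.
by apply: planeP; rewrite !planeE; field.
Qed.

End Construction.

End Sight.

(** * Oscillating solutions of the functional equation *)

Section Wave.
Context {R : realType}.
Implicit Types (S : set (plane R)) (O : plane R) (t s r c e : R).

Lemma is_derive_cosf (f : R -> R) (df t : R) : is_derive t 1 f df ->
  is_derive t 1 (fun x => cos (f x)) (- sin (f t) * df).
Proof. by move=> D; exact: (@is_derive1_comp _ cos f t _ _ (is_derive_cos (f t)) D). Qed.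

Lemma is_derive_sinf (f : R -> R) (df t : R) : is_derive t 1 f df ->
  is_derive t 1 (fun x => sin (f x)) (cos (f t) * df).
Proof. by move=> D; exact: (@is_derive1_comp _ sin f t _ _ (is_derive_sin (f t)) D). Qed.

Lemma is_derive_mulf (f g : R -> R) (df dg t : R) : is_derive t 1 f df ->
  is_derive t 1 g dg -> is_derive t 1 (fun x => f x * g x) (df * g t + f t * dg).
Proof.
move=> Df Dg; apply: (@is_derive_eq _ _ _ _ _ _ _ _ (is_deriveM Df Dg)).
by rewrite /GRing.scale/=; ring.
Qed.

Lemma is_derive_mulc (k : R) (f : R -> R) (df t : R) : is_derive t 1 f df ->
  is_derive t 1 (fun x => k * f x) (k * df).
Proof.
move=> D; have := is_derive_mulf (is_derive_cst k t 1) D.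
by rewrite mul0r add0r.
Qed.

Definition wave c e (q : nat) t : R := c / 2 + e * cos (q%:R * t).

Definition wave_shape O r c e q := shape_of_support O (fun t => r * cos (wave c e q t)).

Section WaveSupport.
Variables (c e : R) (q : nat).

Let b := wave c e q.
Let b1 t : R := - (e * q%:R) * sin (q%:R * t).
Let b2 t : R := - (e * q%:R ^+ 2) * cos (q%:R * t).

Let dq t : is_derive t 1 (fun x => q%:R * x : R) q%:R.
Proof. by have := is_derive_mulc q%:R (is_derive_id t 1); rewrite mulr1. Qed.

Let db t : is_derive t 1 b (b1 t).
Proof.
have D := is_derive_mulc e (is_derive_cosf (dq t)).
apply: (@is_derive_eq _ _ _ _ _ _ _ _ (is_deriveD (is_derive_cst (c / 2) t 1) D)).
by rewrite /b1; ring.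
Qed.

Let db1 t : is_derive t 1 b1 (b2 t).
Proof.
apply: (@is_derive_eq _ _ _ _ _ _ _ _ (is_derive_mulc (- (e * q%:R)) (is_derive_sinf (dq t)))).
by rewrite /b2; ring.
Qed.

Lemma continuous_wave : continuous (wave c e q).
Proof.
move=> x; apply/differentiable_continuous/derivable1_diffP.
by have [] := db x.
Qed.

Lemma periodic_wave : periodic (wave c e q) (pi *+ 2).
Proof.
move=> t; rewrite /wave; congr (_ + _ * _).
by rewrite mulrDr mulr_natl [q%:R * _]mulr_natl (periodicn (@cosD2pi R)).
Qed.

Lemma wave_bounds t : 0 < e -> c / 2 - e <= wave c e q t <= c / 2 + e.
Proof.
move=> e0; have h1 := cos_le1 (q%:R * t : R); have h2 := cos_geN1 (q%:R * t : R).
have := ler_wpM2l (ltW e0) h1; have := ler_wpM2l (ltW e0) h2.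
by rewrite /wave; lra.
Qed.

(** For h = r cos b, h + h'' = r (cos b (1 - b'^2) - b'' sin b). The bound [d] keeps cos b >= cos d
    > 0, and the smallness of [e] gives b'^2 <= 1/2 and b'' sin b <= cos d / 2. *)
Lemma wave_support O r d : 0 < r -> 0 < e -> (0 < q)%N ->
  0 <= c / 2 - e -> c / 2 + e <= d -> d < pi / 2 -> e * q%:R ^+ 2 <= cos d / 2 ->
  forall t, is_support (wave_shape O r c e q) O t (r * cos (wave c e q t)).
Proof.
move=> r0 e0 q0 ce cd dpi small.
have d0 : 0 <= d by lra.
have p2 := pi_gt0 R.
have cd0 : 0 < cos d by rewrite cos_gt0_pihalf//; apply/andP; split; lra.
have cd1 := cos_le1 d.
pose h1 t : R := - r * (sin (b t) * b1 t).
pose h2 t : R := - r * (cos (b t) * b1 t * b1 t + sin (b t) * b2 t).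
apply: (@smooth_support _ _ h1 h2).
- move=> t; apply: (@is_derive_eq _ _ _ _ _ _ _ _ (is_derive_mulc r (is_derive_cosf (db t)))).
  by rewrite /h1; ring.
- move=> t; exact: (is_derive_mulc (- r) (is_derive_mulf (is_derive_sinf (db t)) (db1 t))).
- move=> t; have /andP[bl bu] := wave_bounds t e0; rewrite -/(b t) in bl bu *.
  have cb : cos d <= cos (b t).
    by rewrite leNgt ltr_cos ?in_itv/= -?leNgt; try (apply/andP; split); lra.
  have qR : 1 <= (q%:R : R) by rewrite ler1n.
  pose u := e * q%:R ^+ 2.
  have u0 : 0 <= u by rewrite mulr_ge0 ?exprn_ge0// ltW.
  have eu : e * q%:R <= u by rewrite /u ler_wpM2l ?(ltW e0)// expr2 ler_peMl// ler0n.
  have eq0 : 0 <= e * q%:R by rewrite mulr_ge0 ?ler0n// ltW.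
  have b1sq : b1 t * b1 t <= 1 / 2.
    apply: (@le_trans _ _ ((e * q%:R) ^+ 2)).
      by rewrite /b1 mulrACA mulrNN -!expr2 ler_piMr ?sqr_ge0//.
    have : e * q%:R <= 1 / 2 by rewrite -/u in small; lra.
    by move: eq0; set z := e * _ => z0 z1; nra.
  have sb2 : sin (b t) * b2 t <= u.
    apply: le_trans (ler_norm _) _; rewrite normrM /b2 normrM normrN -/u (ger0_norm u0).
    have h := mulr_ile1 (normr_ge0 _) (normr_ge0 _) (sin_max (b t)) (cos_max (q%:R * t)).
    by rewrite mulrCA ler_piMr.
  have -> : r * cos (wave c e q t) + h2 t =
     r * (cos (b t) * (1 - b1 t * b1 t) - sin (b t) * b2 t) by rewrite /h2 -/(b t); ring.
  rewrite mulr_ge0 ?(ltW r0)// subr_ge0; apply: le_trans sb2 _.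
  have : 0 <= (cos (b t) - cos d) * (1 - b1 t * b1 t) by rewrite mulr_ge0//; lra.
  have : 0 <= cos d * (1 / 2 - b1 t * b1 t) by rewrite mulr_ge0//; lra.
  rewrite -/u in small; lra.
by move=> t; rewrite periodic_wave.
Qed.

End WaveSupport.

Lemma alternating_wave c e (m q : nat) : odd m -> q%:R * c = pi *+ m ->
  forall t, wave c e q (t + c) = c - wave c e q t.
Proof.
move=> om qc t; rewrite /wave mulrDr qc (alternatingn (@cosDpi R)) -signr_odd om.
by rewrite expr1; lra.
Qed.

Lemma disk_support O Z t s : 0 <= s ->
  is_support (disk Z s) O t (dotp (Z - O) (udir t) + s).
Proof.
move=> s0; have shift X : dotp (X - O) (udir t) = dotp (Z - O) (udir t) + dotp (X - Z) (udir t).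
  by rewrite -dotpDl; congr dotp; rewrite [RHS]addrC addrA subrK.
split=> [|X]; last first.
  by rewrite /disk/= eucl_dist_le// shift lerD2l => /dotp_le_norm; apply.
exists (Z + s *: udir t); last first.
  by rewrite shift [_ + _ - Z]addrAC subrr add0r dotpZl dotp_udir subrr cos0 mulr1.
rewrite /disk/= eucl_dist_le// addrAC subrr add0r /dotp !planeE.
suff -> : s * cos t * (s * cos t) + s * sin t * (s * sin t) = s ^+ 2 by [].
by have e := sin2cos2 t; ring: e.
Qed.

(* The support function of a disk is invariant under a nontrivial rotation only
   if it is constant, while [r * cos (wave c e q t)] oscillates. *)
Lemma wave_shape_nondisk O r c e q : 0 < r -> 0 < e -> (1 < q)%N ->
  0 <= c / 2 - e -> c / 2 + e <= pi ->
  (forall t, is_support (wave_shape O r c e q) O t (r * cos (wave c e q t))) ->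
  ~ is_disk (wave_shape O r c e q).
Proof.
move=> r0 e0 q1 ce cpi sup [Z [s [s0 eS]]].
have hE t : r * cos (wave c e q t) = dotp (Z - O) (udir t) + s.
  by apply: support_uniq erefl (sup t) _; rewrite eS; exact: disk_support (ltW s0).
(* Half a period of the wave; [1 < q] puts it below pi, so that sin d is nonzero. *)
set v := Z - O in hE; pose d := pi / q%:R : R.
have q0 : (q%:R : R) != 0 by rewrite pnatr_eq0 -lt0n ltnW.
have qd : q%:R * d = pi by rewrite /d mulrC divfK.
have sd : sin d != 0.
  rewrite gt_eqF// sin_gt0_pi// divr_gt0 ?pi_gt0 ?ltr0n ?(ltnW q1)//=.
  by rewrite ltr_pdivrMr ?ltr0n ?(ltnW q1)// ltr_pMr ?pi_gt0// ltr1n.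
have inv t : dotp v (udir (t + d)) = dotp v (udir (t - d)).
  apply: (addIr s); rewrite -!hE; congr (_ * cos (_ + _ * _)).
  have -> : q%:R * (t + d) = q%:R * (t - d) + pi *+ 2 by rewrite mulrDr mulrBr qd; ring.
  exact: cosD2pi.
have orth t : v.2 * cos t = v.1 * sin t.
  have := inv t; rewrite /dotp !planeE !(cosD, sinD) cosN sinN => h.
  apply: (mulIf sd); lra.
have v2 : v.2 = 0 by have := orth 0; rewrite cos0 sin0 mulr1 mulr0.
have v1 : v.1 = 0.
  by have := orth (pi / 2); rewrite cos_pihalf sin_pihalf mulr1 mulr0.
have hs t : r * cos (wave c e q t) = s by rewrite hE /dotp v1 v2 !mul0r !add0r.
(* The wave has its maximum at 0 and its minimum at [d]. *)
have : r * cos (c / 2 + e) = r * cos (c / 2 - e).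
  have := hs 0; have := hs d; rewrite /wave mulr0 cos0 mulr1 qd cospi mulrN1.
  by move=> -> ->.
have rN : r != 0 by rewrite gt_eqF.
move=> /(mulfI rN)/cos_inj; rewrite !in_itv/= => h.
have : c / 2 + e = c / 2 - e by apply: h; apply/andP; split; lra.
lra.
Qed.

Lemma wave_shapes O r a (m q : nat) : 0 < r -> 0 < a < pi -> (1 < q)%N -> odd m ->
  q%:R * (pi - a) = pi *+ m ->
  exists2 d, 0 < d & forall e, 0 < e < d ->
    [/\ constant_angle_shape O r a (wave_shape O r (pi - a) e q),
        ~ is_disk (wave_shape O r (pi - a) e q),
        0 <= (pi - a) / 2 + e <= pi &
        forall t, is_support (wave_shape O r (pi - a) e q) O t
          (r * cos (wave (pi - a) e q t))].
Proof.
move=> r0 apos q1 om qc; have [a0 api] := andP apos.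
set c := pi - a in qc *.
have c0 : 0 < c by rewrite /c; lra.
have cp : c < pi by rewrite /c; lra.
(* The midpoint of c / 2 and pi / 2, a ceiling for the wave that keeps its cosine away from 0. *)
pose w := c / 4 + pi / 4.
have cw : 0 < cos w by rewrite cos_gt0_pihalf// /w; apply/andP; split; lra.
have q2 : 0 < (q%:R : R) ^+ 2 by rewrite exprn_gt0// ltr0n ltnW.
(* The three bounds keep the wave positive, keep it below [w], and make its curvature small enough
   for [wave_support]. *)
pose d := Num.min (Num.min (c / 2) (w - c / 2)) (cos w / 2 / q%:R ^+ 2).
exists d; first by rewrite !lt_min !divr_gt0//= andbT /w; lra.
move=> e /andP[e0]; rewrite !lt_min => /andP[/andP[e1 e2]].
rewrite ltr_pdivlMr// => e3.
have sup : forall t, is_support (wave_shape O r c e q) O t (r * cos (wave c e q t)).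
  by apply: (@wave_support c e q O r w) => //; rewrite /w in e2 *; try lra; exact: ltnW.
have [w1 w2] : 0 <= c / 2 - e /\ c / 2 + e <= pi by rewrite /w in e2; split; lra.
split => //; last by apply/andP; split; lra.
  apply: constant_angle_of_support => //; rewrite -/c.
  - exact: continuous_wave.
  - move=> t; have /andP[b1 b2] := wave_bounds c q t e0.
    by apply/andP; split; lra.
  - exact: alternating_wave om qc.
exact: wave_shape_nondisk sup.
Qed.

(** Countable sets are Lebesgue-null, but this interval has measure [d]. *)
Lemma uncountable_itv (d : R) : 0 < d -> ~ countable `]0, d[%classic.
Proof.
move=> d0 /countable_lebesgue_measure0; rewrite lebesgue_measure_itv/= lte_fin d0.
by rewrite sube0 => /eqP; rewrite eqe gt_eqF.
Qed.

(** The support value at angle 0 determines the amplitude [e], since cos is injective on [0, pi]. An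
    enumeration of the shapes would thus enumerate an interval of amplitudes. *)
Lemma uncountable_nondisk O r a (m q : nat) : 0 < r -> 0 < a < pi -> (1 < q)%N ->
  odd m -> q%:R * (pi - a) = pi *+ m ->
  ~ countable [set S | constant_angle_shape O r a S /\ ~ is_disk S].
Proof.
move=> r0 apos q1 om qc /countable_injP[f finj].
have [d d0 wd] := wave_shapes O r0 apos q1 om qc.
apply: (uncountable_itv d0); apply/countable_injP.
exists (fun e => f (wave_shape O r (pi - a) e q)) => e e'.
rewrite !inE/= !in_itv/= => /wd[ca nd itv sup] /wd[ca' nd' itv' sup'].
move=> /finj; rewrite !inE => /(_ (conj ca nd) (conj ca' nd')) eS.
have /support_uniq := sup 0; rewrite eS => /(_ _ _ erefl (sup' 0)).
have rN : r != 0 by rewrite gt_eqF.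
rewrite /wave mulr0 cos0 !mulr1 => /(mulfI rN)/cos_inj; rewrite !in_itv/=.
by move=> /(_ itv itv')/addrI.
Qed.

End Wave.

(** * The equivalence and the uncountability *)

Unset Implicit Arguments.
Set Strict Implicit.
Set Printing Implicit Defensive.

Theorem theorem1p3 (R : realType) (O : plane R) (r : R) (hr : 0 < r)
    (alpha : R) (halpha : 0 < alpha < pi) :
  ((exists S : set (plane R),
      constant_angle_shape O r alpha S /\ ~ is_disk S) <->
   (exists p q : nat,
      [/\ (0 < p < q)%N, coprime p q, odd (q - p) &
          alpha = p%:R / q%:R * pi])) /\
  ((exists p q : nat,
      [/\ (0 < p < q)%N, coprime p q, odd (q - p) &
          alpha = p%:R / q%:R * pi]) ->
   ~ countable [set S : set (plane R) |
        constant_angle_shape O r alpha S /\ ~ is_disk S]).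
Proof.
have unc : (exists p q : nat,
      [/\ (0 < p < q)%N, coprime p q, odd (q - p) &
          alpha = p%:R / q%:R * pi]) ->
   ~ countable [set S : set (plane R) |
        constant_angle_shape O r alpha S /\ ~ is_disk S].
  move=> [p [q [/andP[p0 pq] _ opq ea]]].
  have q1 : (1 < q)%N by exact: leq_ltn_trans pq.
  (* Here pi - alpha = ((q - p) / q) pi, so the odd multiplier is q - p. *)
  apply: (uncountable_nondisk hr halpha q1 opq).
  have qN : (q%:R : R) != 0 by rewrite pnatr_eq0 -lt0n ltnW.
  rewrite ea -[pi *+ _]mulr_natl natrB; last exact: ltnW.
  by field.
split=> //; split=> [[S [shS ndS]]|pq]; first exact: nondisk_angle shS ndS.
(* Existence follows from uncountability, as an empty family would be countable. *)
apply: contrapT => none; apply: (unc pq).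
by rewrite (_ : [set _ | _] = set0) // -subset0 => S shS; apply: none; exists S.
Qed.
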